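(* Let $n\ge 2$ and let $\pi\in M_{2n,2n-1}$ satisfy $\pi(2n-1)=1$. Then $\pi=[2n-1\ 2n-2\ \cdots\ 2\ 1]$ or $\pi=[n+1\ 2\ n+2\ 3\ \cdots\ n\ 1]$.
   Context: Permutations in $S_N$ are written $[\pi(1)\ \cdots\ \pi(N)]$. Pointers: entry $k$ has left pointer $(k-1,k)$ and right pointer $(k,k+1)$; the pointer word $W(\pi)$ lists $L(\pi(1))R(\pi(1))\cdots L(\pi(N))R(\pi(N))$ with $(0,1)$ and $(N,N+1)$ removed. Two distinct pointers form a valid pointer context if their occurrences in $W(\pi)$ interleave ($p\ldots q\ldots p\ldots q$ or $q\ldots p\ldots q\ldots p$). Strategic pile: with $X_N=(0\ 1\ \cdots\ N)$, $Y_\pi=(\pi(N)\ \cdots\ \pi(1)\ 0)$ in cycle notation and $C_\pi=Y_\pi\circ X_N$, $\mathrm{SP}(\pi)$ is the set of numbers after $N$ and before $0$ in the cycle of $C_\pi$ containing $0$ and $N$. $\pi\in S_{2n}$ has maximal strategic pile if $|\mathrm{SP}(\pi)|=2n-1$; then $2n$ is immediately followed by $1$, and its contraction is the element of $S_{2n-1}$ obtained by deleting the entry $2n$. $M_{2n,k}$ is the set of contractions of permutations in $S_{2n}$ with maximal strategic pile and exactly $k$ valid pointer contexts. The second permutation is $[n+1\ 2\ n+2\ 3\ \cdots\ 2n-1\ n\ 1]$, i.e. the pairs $n+j,\ j+1$ for $j=1,\dots,n-1$ followed by $1$. *)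

(* Defs.v *)
From mathcomp Require Import all_boot all_fingroup.

Set Implicit Arguments.
Unset Strict Implicit.
Unset Printing Implicit Defensive.

Section StrategicPile.

Variables (N : nat) (pi : 'S_N).

(* 'S_N permutes {0, ..., N-1}: the word [pi(1) ... pi(N)], and the 1-indexed
   evaluation pi(k) for 1 <= k <= N, shift both positions and values by one. *)
Definition oneline : seq nat := [seq (pi i).+1 | i <- enum 'I_N].

Definition entry (k : nat) : nat := nth 0 oneline k.-1.

Definition lptr (k : nat) : nat * nat := (k.-1, k).
Definition rptr (k : nat) : nat * nat := (k, k.+1).

Definition pointer_word : seq (nat * nat) :=
  [seq p <- flatten [seq [:: lptr k; rptr k] | k <- oneline]
     | (p != (0, 1)) && (p != (N, N.+1))].

Definition valid_context (p q : nat * nat) : bool :=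
  (p != q) && (subseq [:: p; q; p; q] pointer_word
               || subseq [:: q; p; q; p] pointer_word).

(* The remaining pointers are (i, i+1) with 1 <= i <= N-1; an unordered pair
   of distinct pointers is represented by i < j. *)
Definition num_contexts : nat :=
  #|[set ij : 'I_N * 'I_N | [&& 0 < ij.1, ij.1 < ij.2 &
       valid_context (rptr ij.1) (rptr ij.2)]]|.

(* next c is the permutation with cycle notation c; lift ord0 sends the
   0-indexed value i of 'I_N to i+1 in {0, ..., N}. *)
Definition cycX : 'I_N.+1 -> 'I_N.+1 := next (enum 'I_N.+1).

Definition cycY : 'I_N.+1 -> 'I_N.+1 :=
  next (rcons (rev [seq lift ord0 (pi i) | i <- enum 'I_N]) ord0).

Definition cycC : 'I_N.+1 -> 'I_N.+1 := cycY \o cycX.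

(* findex cycC x y is the least m with y = iter m cycC x when y lies on the
   cycle of x. The pile is empty when 0 and N lie on different cycles. *)
Definition SP : {set 'I_N.+1} :=
  [set x | [&& fconnect cycC ord_max ord0, fconnect cycC ord_max x,
               0 < findex cycC ord_max x &
               findex cycC ord_max x < findex cycC ord_max ord0]].

End StrategicPile.

Definition maximal_SP (n : nat) (s : 'S_(2 * n)) : bool :=
  #|SP s| == 2 * n - 1.

Definition is_contraction (n : nat) (s : 'S_(2 * n)) (pi : 'S_(2 * n - 1)) :
    bool :=
  oneline pi == [seq k <- oneline s | k != 2 * n].

(* M n k is M_{2n,k} *)
Definition M (n k : nat) : {set 'S_(2 * n - 1)} :=
  [set pi | [exists s : 'S_(2 * n),
     [&& maximal_SP s, num_contexts s == k & is_contraction s pi]]].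

(* Main.v *)
Require Import Defs.
From mathcomp Require Import all_boot all_fingroup zify.

(* Let m = 2n - 1. Since the big permutation ends in [2n 1], its pointer word is
   a cyclic word in which the entries 2n and 1 merge into one: the entry e
   carries the pointers e - 1 and e modulo m, and the pointers become the m
   chords of a chord diagram.

   If S is a set of pointers such that every pointer interlaces an even number
   of members of S, then the parity of the number of S-letters before a gap
   between entries is preserved by C; as C is a single cycle, this parity is
   constant, so S is empty or contains every pointer. In particular no pointer
   is isolated. Every pointer interlaces an even number of others, so
   with only m valid contexts each one interlaces exactly two.

   A handshake argument then shows that all pointers not interlacing a given one
   lie on the same side of it, so the other side has just two letters:
   consecutive entries are at cyclic distance +2 or -1. A change between the two
   kinds of step would create three mutually interlacing pointers, a set
   forbidden by the above unless m = 3. The two constant choices give the two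
   permutations. *)

Set Implicit Arguments.
Unset Strict Implicit.
Unset Printing Implicit Defensive.

(** * Chord diagrams of cyclic arrangements *)

(* For distinct [a], [b], [c], [d]: exactly one of [c], [d] lies between [a]
   and [b]. *)
Definition interlace (a b c d : nat) : bool :=
  (c <= a) (+) (c < b) (+) (d <= a) (+) (d < b).

Lemma interlaceC a b c d : a != c -> a != d -> b != c -> b != d ->
  interlace a b c d = interlace c d a b.
Proof. rewrite /interlace; lia. Qed.

Lemma interlacenn a b : interlace a b a b = false.
Proof. rewrite /interlace; lia. Qed.

Lemma odd_bigD (I : finType) (P : pred I) (F : I -> nat) :
  odd (\sum_(i | P i) F i) = \big[addb/false]_(i | P i) odd (F i).
Proof. exact: (big_morph odd oddD (erefl _)). Qed.

(** Handshake identity: each unordered pair is counted once from either side, and the diagonal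
    contributes nothing. *)
Lemma sum_sym_rel n (r : rel 'I_n) : symmetric r -> irreflexive r ->
  \sum_i \sum_j r i j = (\sum_(i < n) \sum_(j < n | i < j) r i j).*2.
Proof.
move=> rC rI; rewrite -addnn.
have {1}-> : \sum_i \sum_j r i j =
    \sum_(i < n) \sum_(j < n | i < j) r i j + \sum_(i < n) \sum_(j < n | j < i) r i j.
  rewrite -big_split; apply: eq_bigr => i _ /=.
  rewrite (bigID (fun j : 'I_n => i < j)) /=; congr addn.
  rewrite (bigD1 i) ?ltnn //= rI add0n; apply: eq_bigl => j.
  by rewrite -leqNgt ltn_neqAle andbC.
congr addn; rewrite (exchange_big_dep xpredT) //=.
by apply: eq_bigr => i _; apply: eq_bigr => j _; rewrite rC.
Qed.

Lemma bigxor_pred1 (I : finType) (S : pred I) (i : I) :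
  \big[addb/false]_(j | S j) (j == i) = S i.
Proof.
rewrite big_mkcond (bigD1 i) //= big1 ?eqxx ?addbF; first by case: (S i).
by move=> j /negbTE->; rewrite if_same.
Qed.

Lemma val_ordS m (i : 'I_m) :
  (i.+1 = m /\ ordS i = 0 :> nat) \/ (i.+1 < m /\ ordS i = i.+1 :> nat).
Proof.
have := ltn_ord i; rewrite leq_eqVlt => /predU1P[im|im]; [left | right].
- by rewrite /= im modnn.
- by rewrite /= modn_small.
Qed.

Section Chords.

Variables (m : nat) (T : {perm 'I_m}).

(* Entry [i.+1] sits at position [T i], its two pointers at [(T i).*2] and
   [(T i).*2.+1]; chord [i] joins the right pointer of entry [i.+1] to the left
   pointer of its cyclic successor. *)
Definition chord_out (i : 'I_m) : nat := (T i).*2.+1.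
Definition chord_in (i : 'I_m) : nat := (T (ordS i)).*2.

Definition cross (i j : 'I_m) : bool :=
  interlace (chord_out i) (chord_in i) (chord_out j) (chord_in j).

Lemma chord_out_eq i j : (chord_out i == chord_out j) = (i == j).
Proof.
apply/eqP/eqP => [|-> //]; rewrite /chord_out => e.
by apply: (perm_inj (s := T)); apply: val_inj => /=; lia.
Qed.

Lemma chord_in_eq i j : (chord_in i == chord_in j) = (i == j).
Proof.
apply/eqP/eqP => [|-> //]; rewrite /chord_in => e; apply: (can_inj (@ordSK m)).
by apply: (perm_inj (s := T)); apply: val_inj => /=; lia.
Qed.

Lemma chord_out_in i j : chord_out i != chord_in j.
Proof. rewrite /chord_out /chord_in; lia. Qed.

Lemma chord_out_lt i : chord_out i < m.*2.
Proof. have := ltn_ord (T i); rewrite /chord_out; lia. Qed.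

Lemma chord_in_lt i : chord_in i < m.*2.
Proof. have := ltn_ord (T (ordS i)); rewrite /chord_in; lia. Qed.

Lemma crossC : symmetric cross.
Proof.
move=> i j; have [->//|ij] := eqVneq i j; apply: interlaceC.
- by rewrite chord_out_eq.
- exact: chord_out_in.
- by rewrite eq_sym chord_out_in.
- by rewrite chord_in_eq.
Qed.

Lemma crossnn : irreflexive cross.
Proof. move=> i; exact: interlacenn. Qed.

Lemma chord_at p : p < m.*2 -> exists j, chord_out j = p \/ chord_in j = p.
Proof.
move=> pm; have hm : p./2 < m by lia.
have [po|pe] := boolP (odd p).
- exists ((T^-1)%g (Ordinal hm)); left; rewrite /chord_out permKV /=; lia.
- exists (ord_pred ((T^-1)%g (Ordinal hm))); right.
  rewrite /chord_in ord_predK permKV /=; lia.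
Qed.

(** The parity of the number of ends of [S]-chords before place [x], the quantity that C
    preserves. *)
Definition height (S : pred 'I_m) (x : nat) : bool :=
  \big[addb/false]_(j | S j) ((chord_out j < x) (+) (chord_in j < x)).

Lemma height0 S : height S 0 = false.
Proof. by rewrite /height big1. Qed.

Lemma height_end S : height S m.*2 = false.
Proof. by rewrite /height big1 // => j _; rewrite chord_out_lt chord_in_lt. Qed.

(** The gap after one end of chord [i] is compared with the gap before the other end. Chord [j]
    contributes to the difference exactly when one of its ends lies between, so an even sum makes
    the two heights equal. *)
Lemma height_chord S i : height S (chord_out i).+1 (+) height S (chord_in i) =
  odd (\sum_(j | S j) cross i j).
Proof.
rewrite odd_bigD -big_split; apply: eq_bigr => j _ /=.
rewrite oddb /cross /interlace !ltnS.
by do 4! case: (_ <= _).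
Qed.

(** Passing an entry means passing its two letters: the right pointer starts chord [i], the left
    pointer ends the chord of [ord_pred i]. *)
Lemma height_entry S i : height S (T i).*2.+2 =
  height S (T i).*2 (+) S i (+) S (ord_pred i).
Proof.
rewrite -(bigxor_pred1 S i) -(bigxor_pred1 S (ord_pred i)) -!big_split.
apply: eq_bigr => j _ /=.
have -> : (j == i) = (chord_out j == chord_out i) by rewrite chord_out_eq.
have -> : (j == ord_pred i) = (chord_in j == chord_in (ord_pred i)).
  by rewrite chord_in_eq.
rewrite /chord_out /chord_in ord_predK; lia.
Qed.

Lemma height_all k : k <= m -> height predT k.*2 = false.
Proof.
elim: k => [|k IH] km; first exact: height0.
have := height_entry predT ((T^-1)%g (Ordinal km)).
by rewrite permKV /= -doubleS IH // ltnW.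
Qed.

(** Take [S] to be everything in [height_chord]: both heights are then taken at gaps between
    entries, which an even number of letters precedes. *)
Lemma even_degree i : ~~ odd (\sum_j cross i j).
Proof.
rewrite -(height_chord predT) /chord_in -doubleS.
by rewrite !height_all // ltnW.
Qed.

(** * Diagrams in which every chord crosses exactly two others *)

Section TwoRegular.

Hypothesis even_const : forall S : pred 'I_m,
  (forall i, ~~ odd (\sum_(j | S j) cross i j)) -> forall i j, S i = S j.
Hypothesis degree2 : forall i, \sum_j cross i j = 2.

(** The crossing graph is connected: a set closed under crossing contains both neighbours of each of
    its members and no neighbour of any other chord, so it satisfies the parity condition. *)
Lemma closed_const (S : pred 'I_m) :
  (forall j k, S j -> cross j k -> S k) -> forall i j, S i = S j.
Proof.
move=> Scl; apply: even_const => i; have [Si|Si] := boolP (S i).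
- rewrite (_ : \sum_(j | S j) _ = 2) // -(degree2 i) [RHS](bigID S) /=.
  rewrite [X in _ = _ + X]big1 ?addn0 // => j Sj.
  by case: (boolP (cross i j)) => // /(Scl _ _ Si); rewrite (negbTE Sj).
- rewrite big1 // => j Sj; rewrite crossC.
  by case: (boolP (cross j i)) => // /(Scl _ _ Sj); rewrite (negbTE Si).
Qed.

Lemma no_three_crossings i j1 j2 j3 : j1 != j2 -> j1 != j3 -> j2 != j3 ->
  cross i j1 -> cross i j2 -> cross i j3 -> False.
Proof.
move=> n12 n13 n23 c1 c2 c3; have := degree2 i.
rewrite (bigD1 j1) //= (bigD1 j2) 1?eq_sym //= (bigD1 j3) /=; last first.
  by rewrite ![j3 == _]eq_sym n13 n23.
by rewrite c1 c2 c3.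
Qed.

(* [S] is one side of chord [i]: it can only be left through the two chords
   crossing [i], and by the handshake lemma it is so an even number of times. *)
Lemma side_even (S : pred 'I_m) i :
  (forall j, S j -> ~~ cross i j) ->
  (forall j k, S j -> cross j k -> S k || cross i k) ->
  ~~ odd (\sum_(k | cross i k) \sum_(j | S j) cross k j).
Proof.
move=> Si Sl.
have hs : ~~ odd (\sum_(k | S k) \sum_(j | S j) cross k j).
  pose r k j := [&& S k, S j & cross k j].
  have rE : \sum_k \sum_j r k j = \sum_(k | S k) \sum_(j | S j) cross k j.
    rewrite [RHS]big_mkcond; apply: eq_bigr => k _; rewrite /r; case: (S k) => /=.
      by rewrite [RHS]big_mkcond; apply: eq_bigr => j _; case: (S j).
    by rewrite big1.
  rewrite -rE sum_sym_rel ?odd_double // => [k j|k]; rewrite /r.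
    by rewrite andbCA crossC.
  by rewrite crossnn !andbF.
have : ~~ odd (\sum_(j | S j) \sum_k cross j k).
  by rewrite odd_bigD big1 // => j _; rewrite degree2.
(* A chord crossing a member of [S] is in [S] or crosses [i], never both, so the degree sum
   splits. *)
have -> : \sum_(j | S j) \sum_k cross j k =
    \sum_(k | S k) \sum_(j | S j) cross k j
    + \sum_(k | cross i k) \sum_(j | S j) cross k j.
  rewrite [X in _ + X]exchange_big -big_split; apply: eq_bigr => j Sj /=.
  rewrite (bigID S) /=; congr addn.
  rewrite (bigID (cross i)) /= [X in _ + X]big1 ?addn0; last first.
    move=> k /andP[Sk ck]; case: (boolP (cross j k)) => // /(Sl _ _ Sj).
    by rewrite (negbTE Sk) (negbTE ck).
  apply: eq_big => [k|k _]; last by rewrite crossC.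
  by case: (boolP (S k)) => // /Si /negbTE.
by rewrite oddD (negbTE hs).
Qed.

(** If no crossing leads out of [S], then [S] is closed under crossing, hence constant, and it
    misses [i]. *)
Lemma side_empty (S : pred 'I_m) i : ~~ S i ->
  (forall j k, S j -> cross j k -> S k || cross i k) ->
  \sum_(k | cross i k) \sum_(j | S j) cross k j = 0 ->
  forall j, ~~ S j.
Proof.
move=> Si Sl e0 j; suff -> : S j = S i by [].
apply: closed_const => {}j k Sj cjk; have /orP[//|cik] := Sl _ _ Sj cjk.
move: e0; rewrite (bigD1 k) //= (bigD1 j) //= crossC cjk; lia.
Qed.

Definition inside (i j : 'I_m) : bool :=
  let u := minn (chord_out i) (chord_in i) in
  let v := maxn (chord_out i) (chord_in i) in
  (u < chord_out j < v) && (u < chord_in j < v).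

Definition outside (i j : 'I_m) : bool :=
  let u := minn (chord_out i) (chord_in i) in
  let v := maxn (chord_out i) (chord_in i) in
  ((chord_out j < u) || (v < chord_out j)) && ((chord_in j < u) || (v < chord_in j)).

(** Each of the two chords crossing [i] crosses only one further chord, so at most two crossings
    reach the two sides together. Each side receives an even number, so one of them receives
    none. *)
Lemma one_side_empty i :
  (forall j, ~~ inside i j) \/ (forall j, ~~ outside i j).
Proof.
have inN : ~~ inside i i by rewrite /inside; lia.
have outN : ~~ outside i i by rewrite /outside; lia.
have inC j : inside i j -> ~~ cross i j.
  rewrite /inside /cross /interlace; lia.
have outC j : outside i j -> ~~ cross i j.
  rewrite /outside /cross /interlace; lia.
have inL j k : inside i j -> cross j k -> inside i k || cross i k.
  have [<-|nik] := eqVneq i k; first by move=> /inC; rewrite crossC => /negbTE ->.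
  have := chord_out_eq i k; have := chord_in_eq i k; rewrite (negbTE nik).
  have := chord_out_in i k; have := chord_out_in k i.
  rewrite /inside /cross /interlace; lia.
have outL j k : outside i j -> cross j k -> outside i k || cross i k.
  have [<-|nik] := eqVneq i k; first by move=> /outC; rewrite crossC => /negbTE ->.
  have := chord_out_eq i k; have := chord_in_eq i k; rewrite (negbTE nik).
  have := chord_out_in i k; have := chord_out_in k i.
  rewrite /outside /cross /interlace; lia.
have ein := side_even inC inL; have eout := side_even outC outL.
have : \sum_(k | cross i k) \sum_(j | inside i j) cross k j
     + \sum_(k | cross i k) \sum_(j | outside i j) cross k j <= 2.
  rewrite -big_split -[2](degree2 i) [leqRHS]big_mkcond [leqLHS]big_mkcond /=.
  apply: leq_sum => k _; case: ifP => // cik.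
  have := degree2 k; rewrite (bigD1 i) //= crossC cik (bigID (inside i)) /=.
  rewrite [\sum_(j | inside i j) _](_ : _ =
    \sum_(j | (j != i) && inside i j) cross k j); last first.
    by apply: eq_bigl => j; case: eqVneq => // ->; rewrite (negbTE inN).
  set x := \sum_(j | _) _; set y := \sum_(j | _) _; set z := \sum_(j | _) _.
  suff : z <= y by move=> *; lia.
  rewrite /z /y [leqRHS]big_mkcond [leqLHS]big_mkcond; apply: leq_sum => j _.
  case: ifP => // oj; case: ifP => //; case: eqVneq oj => [->|_] //=.
    by rewrite (negbTE outN).
  rewrite /outside /inside; lia.
move: ein eout (side_empty inN inL) (side_empty outN outL).
set x := \sum_(k | _) _; set y := \sum_(k | _) _ => ex ey x0 y0 xy.
have [/x0|/y0] : x = 0 \/ y = 0 by lia.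
- by left.
- by right.
Qed.

(** For [Q] a side of [i] containing no whole chord: distinct letters in [Q] belong to distinct
    chords, all crossing [i], so there are at most two. *)
Lemma three_positions (Q : pred nat) i p1 p2 p3 :
  (forall j, Q (chord_out j) (+) Q (chord_in j) -> cross i j) ->
  (forall j, ~~ (Q (chord_out j) && Q (chord_in j))) ->
  p1 < m.*2 -> p2 < m.*2 -> p3 < m.*2 -> p1 != p2 -> p1 != p3 -> p2 != p3 ->
  Q p1 -> Q p2 -> Q p3 -> False.
Proof.
move=> Qc QN /chord_at[j1 h1] /chord_at[j2 h2] /chord_at[j3 h3] n12 n13 n23 q1 q2 q3.
have dist p p' j j' : Q p -> Q p' -> p != p' ->
    chord_out j = p \/ chord_in j = p -> chord_out j' = p' \/ chord_in j' = p' ->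
    j != j'.
  move=> qp qp' npp' hj hj'; apply/eqP => ejj'; move: hj'; rewrite -ejj' => hj'.
  move: npp' qp qp' (QN j).
  by case: hj => <-; case: hj' => <-; rewrite ?eqxx // => _ -> ->.
have crs p j : Q p -> chord_out j = p \/ chord_in j = p -> cross i j.
  move=> qp hj; apply: Qc; have := QN j.
  by case: hj => ->; rewrite qp /= ?andbT => /negbTE ->.
apply: (@no_three_crossings i j1 j2 j3); eauto.
Qed.

(** The side of chord [i] that contains no chord has at most two letters. Their number is even, and
    not zero since [i] crosses something, so it is two. The first and third cases arise when this
    side is the inside, the others when it is the outside. *)
Lemma chord_step i (a := val (T i)) (b := val (T (ordS i))) :
  [\/ b = a + 2, b + m = a + 2, b.+1 = a | b.+1 = a + m].
Proof.
have am : a < m by exact: ltn_ord.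
have bm : b < m by exact: ltn_ord.
have [j cij] : exists j, cross i j.
  have [j /eqP|] := pickP (fun j => cross i j); first by exists j; apply/eqP.
  by move=> h; have := degree2 i; rewrite big1 // => j _; rewrite h.
have jo := chord_out_lt j; have ji := chord_in_lt j.
have nij : i != j by apply: contraTneq cij => ->; rewrite crossnn.
have := chord_out_eq i j; have := chord_in_eq i j; rewrite (negbTE nij).
have := chord_out_in i j; have := chord_out_in j i.
rewrite -[chord_out i]/(a.*2.+1) -[chord_in i]/(b.*2) => no1 no2 no3 no4.
move: cij; rewrite /cross -[chord_out i]/(a.*2.+1) -[chord_in i]/(b.*2) => cij.
have [noin|noout] := one_side_empty i.
- pose Q p := minn a.*2.+1 b.*2 < p < maxn a.*2.+1 b.*2.
  have QN k : ~~ (Q (chord_out k) && Q (chord_in k)) by exact: noin.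
  have Qc k : Q (chord_out k) (+) Q (chord_in k) -> cross i k.
    have [<-|nik] := eqVneq i k.
      rewrite /Q -[chord_out i]/(a.*2.+1) -[chord_in i]/(b.*2); lia.
    have := chord_out_eq i k; have := chord_in_eq i k; rewrite (negbTE nik).
    have := chord_out_in i k; have := chord_out_in k i.
    rewrite /cross /interlace /Q -[chord_out i]/(a.*2.+1) -[chord_in i]/(b.*2); lia.
  pose u := minn a.*2.+1 b.*2.
  have := @three_positions Q i u.+1 u.+2 u.+3 Qc QN.
  rewrite /u /Q => tp.
  (* The bounds say that at most two letters lie strictly between the ends of the chord. *)
  have [h|h] : b <= a + 2 /\ a <= b.+1 \/ ~ (b <= a + 2 /\ a <= b.+1) by lia.
    move: cij; rewrite /interlace => cij.
    suff : b = a + 2 \/ b.+1 = a by case=> ->; [constructor 1 | constructor 3].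
    lia.
  by exfalso; apply: tp; lia.
- pose Q p := (p < minn a.*2.+1 b.*2) || (maxn a.*2.+1 b.*2 < p).
  have QN k : ~~ (Q (chord_out k) && Q (chord_in k)) by exact: noout.
  have Qc k : Q (chord_out k) (+) Q (chord_in k) -> cross i k.
    have [<-|nik] := eqVneq i k.
      rewrite /Q -[chord_out i]/(a.*2.+1) -[chord_in i]/(b.*2); lia.
    have := chord_out_eq i k; have := chord_in_eq i k; rewrite (negbTE nik).
    have := chord_out_in i k; have := chord_out_in k i.
    rewrite /cross /interlace /Q -[chord_out i]/(a.*2.+1) -[chord_in i]/(b.*2); lia.
  pose u := minn a.*2.+1 b.*2; pose v := maxn a.*2.+1 b.*2.
  have tp p1 p2 p3 := @three_positions Q i p1 p2 p3 Qc QN; rewrite /Q in tp.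
  have [h|h] : m.*2 <= v - u + 3 \/ v - u + 3 < m.*2 by lia.
    move: cij; rewrite /interlace => cij.
    suff : b + m = a + 2 \/ b.+1 = a + m.
      by case=> ->; [constructor 2 | constructor 4].
    rewrite /u /v in h; lia.
  exfalso; rewrite /u /v in h.
  (* There are [u] letters before the chord; when these are fewer than three, the rest are taken
     from the end of the word. *)
  have [u3|[u2|[u1|u0]]] : 2 < u \/ u = 2 \/ u = 1 \/ u = 0 by lia.
  + rewrite /u in u3; apply: (tp 0 1 2); lia.
  + rewrite /u in u2; apply: (tp 0 1 m.*2.-1); lia.
  + rewrite /u in u1; apply: (tp 0 m.*2.-2 m.*2.-1); lia.
  + rewrite /u in u0; apply: (tp (m.*2 - 3) m.*2.-2 m.*2.-1); lia.
Qed.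

(** Three mutually crossing chords use up each other's two crossings, so they form a closed set,
    hence the whole diagram. *)
Lemma triangle_closed i j k : i != j -> i != k -> j != k ->
  cross i j -> cross i k -> cross j k -> m <= 3.
Proof.
move=> nij nik njk cij cik cjk.
pose S := pred3 i j k.
have Scl x y : S x -> cross x y -> S y.
  move=> Sx cxy; apply/negPn/negP; rewrite /S /= !negb_or => /and3P[yi yj yk].
  case/or3P: Sx => /eqP ex; rewrite {}ex in cxy.
  - by apply: (@no_three_crossings i j k y); rewrite // eq_sym.
  - by apply: (@no_three_crossings j i k y); rewrite // 1?eq_sym // crossC.
  - by apply: (@no_three_crossings k i j y); rewrite // 1?eq_sym // crossC.
have /(_ i) Sc := closed_const Scl.
have /card_uniqP/= <- : uniq [:: i; j; k] by rewrite /= !inE negb_or nij nik njk.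
rewrite -[leqLHS](card_ord m).
apply/subset_leq_card/subsetP => x _; move: (Sc x).
by rewrite /S /= eqxx /= !inE => /esym.
Qed.

Definition down_step i := (T (ordS i)).+1 = T i \/ (T (ordS i)).+1 = T i + m.
Definition up_step i := T (ordS i) = T i + 2 :> nat \/ T (ordS i) + m = T i + 2.

Lemma T_neq i j : i != j -> T i != T j :> nat.
Proof. by rewrite -(inj_eq (@perm_inj _ T)). Qed.

Lemma four_distinct (j0 j1 j2 j3 : 'I_m) : 3 < m ->
  ordS j0 = j1 -> ordS j1 = j2 -> ordS j2 = j3 ->
  [/\ j0 != j1, j0 != j2, j1 != j2, j0 != j3 & j1 != j3 /\ j2 != j3].
Proof.
move=> m3 e1 e2 e3.
have := (val_ordS j0, val_ordS j1, val_ordS j2); rewrite e1 e2 e3 => -[[v1 v2] v3].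
by split; [| | | |split]; apply/eqP => /(congr1 val) /=; lia.
Qed.

(** Up then down visits places x, x + 2, x + 1. These two chords cross, and the chord leaving the
    third entry has one end inside both and the other outside both. For down then up, at y, y - 1, y
    + 1, the chord entering the first entry plays this role. *)
Lemma steps_constant i : 3 < m ->
  (up_step i -> down_step (ordS i) -> False) /\
  (down_step i -> up_step (ordS i) -> False).
Proof.
move=> m3.
(* The triangle is [j0], [j1], [j2] in both cases; the chord completing it is [j2] in the first and
   [j0] in the second. *)
have tri j0 j1 j2 j3 : ordS j0 = j1 -> ordS j1 = j2 -> ordS j2 = j3 ->
    (up_step j0 /\ down_step j1) \/ (down_step j1 /\ up_step j2) -> False.
  move=> e1 e2 e3; rewrite /up_step /down_step e1 e2 e3 => h.
  have [n01 n02 n12 n03 [n13 n23]] := four_distinct m3 e1 e2 e3.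
  have := (T_neq n01, T_neq n02, T_neq n03, T_neq n12, T_neq n13, T_neq n23).
  have := (ltn_ord (T j0), ltn_ord (T j1), ltn_ord (T j2), ltn_ord (T j3)).
  move=> [[[t0 t1] t2] t3] [[[[[m01 m02] m03] m12] m13] m23].
  have : m <= 3; last by rewrite leqNgt m3.
  apply: (triangle_closed n01 n02 n12);
    rewrite /cross /interlace /chord_out /chord_in ?e1 ?e2 ?e3; lia.
split=> [ui di|di ui].
- by apply: (tri _ _ _ _ erefl erefl erefl); left; split; first exact: ui.
- apply: (tri (ord_pred i) i (ordS i) (ordS (ordS i))); rewrite ?ord_predK //.
  by right.
Qed.

Lemma up_or_down i : up_step i \/ down_step i.
Proof. by rewrite /up_step /down_step; case: (chord_step i); tauto. Qed.

Lemma all_steps : 2 < m -> (forall i, up_step i) \/ (forall i, down_step i).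
Proof.
move=> m2; have m0 : 0 < m by lia.
(* For [m = 3] the steps +2 and -1 agree modulo [m]. *)
have [m3|m3] := leqP m 3.
  right=> i; have [ui|//] := up_or_down i.
  have := (ltn_ord (T i), ltn_ord (T (ordS i))); move: ui; rewrite /up_step /down_step.
  by move=> ui [t0 t1]; lia.
have ind (P : 'I_m -> Prop) : P (Ordinal m0) -> (forall i, P i -> P (ordS i)) ->
    forall i, P i.
  move=> P0 PS [k km]; elim: k km => [|k IH] km.
    by rewrite (_ : Ordinal km = Ordinal m0) //; apply: val_inj.
  have km' : k < m by lia.
  have := PS _ (IH km'); congr P; apply: val_inj.
  by have := val_ordS (Ordinal km') => /=; lia.
have [u0|d0] := up_or_down (Ordinal m0); [left|right]; apply: ind => // i h.
- by have [//|/((steps_constant i m3).1 h)] := up_or_down (ordS i).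
- by have [/((steps_constant i m3).2 h)|//] := up_or_down (ordS i).
Qed.

Lemma positions (m2 : 2 < m) : (forall i : 'I_m, i = 0 :> nat -> T i = m.-1 :> nat) ->
  (forall i : 'I_m, T i = m.-1 - i :> nat) \/
  (forall i : 'I_m, T i = (m.-1 + i.*2) %% m :> nat).
Proof.
move=> T0; have m0 : 0 < m by lia.
have ordSE k (km : k < m) (k1m : k.+1 < m) : ordS (Ordinal km) = Ordinal k1m.
  by apply: val_inj; have := val_ordS (Ordinal km) => /=; lia.
have [u|d] := all_steps m2; [right|left]; case=> k km; elim: k km => [|k IH] km.
- by rewrite T0 // addn0 modn_small // prednK.
- have km' : k < m by lia.
  have := u (Ordinal km'); rewrite /up_step ordSE.
  rewrite IH /= => us.
  rewrite doubleS -addn2 addnA -modnDml.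
  by case: us => <-; rewrite ?modnDr modn_small.
- by rewrite T0 //= subn0.
- have km' : k < m by lia.
  have := d (Ordinal km'); rewrite /down_step ordSE IH /=.
  have := ltn_ord (T (Ordinal km)); lia.
Qed.

End TwoRegular.
End Chords.

(** * The cycle of a maximal strategic pile *)

Lemma size_oneline n (s : 'S_n) : size (oneline s) = n.
Proof. by rewrite size_map size_enum_ord. Qed.

Lemma oneline_uniq n (s : 'S_n) : uniq (oneline s).
Proof.
rewrite map_inj_uniq ?enum_uniq // => i j [] /val_inj; exact: perm_inj.
Qed.

Lemma index_oneline n (s : 'S_n) (i : 'I_n) : index i.+1 (oneline s) = (s^-1)%g i.
Proof.
rewrite -{1}[i](permKV s) index_map ?index_enum_ord // => j k [] /val_inj.
exact: perm_inj.
Qed.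

Lemma mem_oneline n (s : 'S_n) k : (k \in oneline s) = (0 < k <= n).
Proof.
apply/mapP/idP => [[i _ ->]|]; first by rewrite ltn_ord.
case: k => // k kn; exists ((s^-1)%g (Ordinal kn)); first by rewrite mem_enum.
by rewrite permKV.
Qed.

Section Cycle.

Variables (n : nat) (s : 'S_n.+1).

Lemma val_cycX (x : 'I_n.+2) : x != ord_max -> cycX x = x.+1 :> nat.
Proof.
move=> xm; rewrite /cycX next_nth mem_enum inE index_enum_ord.
case E: (enum 'I_n.+2) => [|y e]; first by have := size_enum_ord n.+2; rewrite E.
have /(nth_enum_ord y) : x.+1 < n.+2.
  by rewrite ltn_neqAle ltn_ord -[n.+2]/(ord_max : 'I_n.+2).+1 eqSS xm.
by rewrite E.
Qed.

Lemma val_cycX_max : cycX (ord_max : 'I_n.+2) = 0 :> nat.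
Proof.
rewrite /cycX next_nth mem_enum inE index_enum_ord.
case E: (enum 'I_n.+2) => [|y e]; first by have := size_enum_ord n.+2; rewrite E.
have se : size e = n.+1 by have := size_enum_ord n.+2; rewrite E /= => -[].
by rewrite nth_default ?se //; have := nth_enum_ord y (ltn0Sn n.+1); rewrite E.
Qed.

(** Y maps an entry to its predecessor, and prefixing 0 shifts the word by one place. For [x = 0],
    absent from the word, the index is the length and gives the last entry. *)
Lemma val_cycY (x : 'I_n.+2) :
  cycY s x = nth 0 (0 :: oneline s) (index (x : nat) (oneline s)) :> nat.
Proof.
rewrite /cycY -rev_cons next_rev; last first.
  rewrite /= map_inj_uniq ?enum_uniq; last by move=> i j /lift_inj /perm_inj.
  by rewrite andbT; apply/mapP => -[i _].
set l := map _ _.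
have wE : oneline s = [seq val y | y <- l].
  by rewrite /l -map_comp; apply: eq_map => i; rewrite /= /bump.
have xl : x \in ord0 :: l.
  rewrite inE; case: eqVneq => //= x0; apply/mapP.
  have x1 : x.-1 < n.+1 by have := ltn_ord x; rewrite -val_eqE /= in x0; lia.
  exists ((s^-1)%g (Ordinal x1)); first by rewrite mem_enum.
  rewrite permKV; apply: val_inj; rewrite /= /bump.
  rewrite -val_eqE /= in x0; lia.
rewrite prev_nth xl wE index_map; last exact: val_inj.
rewrite -[0 :: map _ _]/(map val ((ord0 : 'I_n.+2) :: l)) (nth_map ord0) //.
by rewrite ltnS index_size.
Qed.

Lemma val_cycC (x : 'I_n.+2) : x != ord_max ->
  cycC s x = nth 0 (0 :: oneline s) (index x.+1 (oneline s)) :> nat.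
Proof. by move=> xm; rewrite /cycC /= val_cycY val_cycX. Qed.

Lemma val_cycC_max : cycC s ord_max = last 0 (oneline s) :> nat.
Proof.
rewrite /cycC /= val_cycY val_cycX_max memNindex ?mem_oneline //.
by rewrite nth_last.
Qed.

Lemma cycC_inj : injective (cycC s).
Proof.
apply: inj_comp; apply: can_inj (prev_next _); last exact: enum_uniq.
rewrite -rev_cons rev_uniq /= map_inj_uniq ?enum_uniq; last first.
  by move=> i j /lift_inj /perm_inj.
by rewrite andbT; apply/mapP => -[i _].
Qed.

Hypothesis pile : #|SP s| = n.

(** The pile contains neither 0 nor N, and its size is the number of remaining elements. *)
Lemma pileP x : x != ord0 -> x != ord_max -> x \in SP s.
Proof.
move=> x0 xm; have sub : SP s \subset ~: [set ord0; ord_max].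
  apply/subsetP => y; rewrite !inE => /and4P[_ _ y0 y1].
  apply/norP; split; apply/eqP => e; rewrite e ?ltnn in y0 y1 => //.
  by rewrite findex0 in y0.
have /eqP -> : SP s == ~: [set ord0; ord_max].
  rewrite eqEcard sub /= pile cardsCs setCK cards2 card_ord /=; lia.
by rewrite !inE negb_or x0 xm.
Qed.

Hypothesis n1 : 1 < n.

Lemma pile_connect x : fconnect (cycC s) ord_max x.
Proof.
have c0 : fconnect (cycC s) ord_max ord0.
  have nS : 1 < n.+2 by lia.
  (* Membership of 1 in the pile is enough, as the pile is empty unless 0 and N share a cycle. *)
  have : Ordinal nS \in SP s by apply: pileP; rewrite -val_eqE /=; lia.
  by rewrite inE => /and4P[].
have [->//|x0] := eqVneq x ord0.
have [->|xm] := eqVneq x ord_max; first exact: connect0.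
by have := pileP x0 xm; rewrite inE => /and4P[].
Qed.

Lemma pile_order : fingraph.order (cycC s) ord_max = n.+2.
Proof.
rewrite /fingraph.order -[RHS]card_ord; apply: eq_card => x; rewrite !inE.
exact: pile_connect.
Qed.

(** Any other element in the last place of the cycle would be in the pile and so come before 0. *)
Lemma iter_pile_last : iter n.+1 (cycC s) ord_max = ord0.
Proof.
apply/eqP/negPn/negP => x0.
have fi : findex (cycC s) ord_max (iter n.+1 (cycC s) ord_max) = n.+1.
  by rewrite findex_iter // pile_order.
have xm : iter n.+1 (cycC s) ord_max != ord_max.
  by apply/eqP => e; rewrite e findex0 in fi.
have := pileP x0 xm; rewrite inE => /and4P[_ _ _]; rewrite fi.
by have := findex_max (pile_connect ord0); rewrite pile_order; lia.
Qed.

Lemma cycC0 : cycC s ord0 = ord_max.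
Proof.
have := iter_order cycC_inj ord_max; rewrite pile_order iterS => <-.
by rewrite iter_pile_last.
Qed.

(** Induction along the cycle of C from N; 0 comes last, so no step starts there. *)
Lemma pile_ind (P : 'I_n.+2 -> Prop) : P (cycC s ord_max) ->
  (forall x, x != ord0 -> x != ord_max -> P x -> P (cycC s x)) ->
  forall x, x != ord_max -> P x.
Proof.
move=> P1 PS x xm; rewrite -(iter_findex (pile_connect x)).
have : findex (cycC s) ord_max x != 0.
  by apply: contra xm => /eqP e; rewrite -(iter_findex (pile_connect x)) e.
have := findex_max (pile_connect x); rewrite pile_order.
elim: (findex _ _ _) => // -[|k] IH kn _ //; rewrite iterS.
have fi : findex (cycC s) ord_max (iter k.+1 (cycC s) ord_max) = k.+1.
  by rewrite findex_iter // pile_order; lia.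
apply: PS; last by apply: IH => //; lia.
- apply/eqP => e; move: fi; rewrite e -iter_pile_last findex_iter ?pile_order //; lia.
- by apply/eqP => e; rewrite e findex0 in fi.
Qed.

(** C maps 0 to the entry before 1, and [cycC0] identifies this entry as N. *)
Lemma oneline_pile : exists p1 p2, oneline s = p1 ++ n.+1 :: 1 :: p2.
Proof.
have := congr1 val cycC0; rewrite /= val_cycC //.
set w := oneline s; have w1 : 1 \in w by rewrite mem_oneline.
case E: (index 1 w) => [|k] //= wk.
have i1 : index 1 w < size w by rewrite index_mem.
exists (take k w), (drop k.+2 w).
rewrite -{1}[w](cat_take_drop k) (drop_nth 0) ?wk; last by lia.
by rewrite (drop_nth 0) -?E // nth_index.
Qed.

End Cycle.

Lemma contraction_shape n (s : 'S_n.+1) (pi : 'S_n) : 1 < n -> #|SP s| = n ->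
  oneline pi = [seq k <- oneline s | k != n.+1] -> entry pi n = 1 ->
  exists p, oneline s = p ++ [:: n.+1; 1] /\ oneline pi = rcons p 1.
Proof.
move=> n1 pile hpi; have [p1 [p2 sE]] := oneline_pile pile n1.
have us := oneline_uniq s.
have piE : oneline pi = p1 ++ 1 :: p2.
  rewrite hpi sE filter_cat /= eqxx /=; have -> /= : 1 != n.+1 by lia.
  move: us; rewrite sE cat_uniq /= !inE !negb_or => /and4P[_ /andP[np1 _] /andP[_ np2] _].
  congr (_ ++ _ :: _); apply/all_filterP/allP => k kp; apply/eqP => e.
    by rewrite -e kp in np1.
  by rewrite -e kp in np2.
rewrite /entry -{2}(size_oneline pi) nth_last piE last_cat /= => l1.
exists p1; rewrite sE.
suff -> : p2 = [::] by rewrite cats1.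
have := oneline_uniq pi; rewrite piE cat_uniq /= => /and4P[_ _ + _].
by case: p2 l1 {sE piE} => //= x p <-; rewrite mem_last.
Qed.

(** * Interlacing pointers of the contraction *)

Lemma subseq_nth (A : eqType) (x0 : A) (t : seq A) (ps : seq nat) :
  sorted ltn ps -> all (fun p => p < size t) ps ->
  subseq [seq nth x0 t p | p <- ps] t.
Proof.
move=> sps /allP ltps; rewrite -{2}(mkseq_nth x0 t); apply: map_subseq.
suff -> : ps = [seq p <- iota 0 (size t) | p \in ps] by exact: filter_subseq.
apply: (irr_sorted_eq ltn_trans ltnn) => //.
  by rewrite sorted_filter ?iota_ltn_sorted //; exact: ltn_trans.
move=> p; rewrite mem_filter mem_iota add0n /=.
by case: (boolP (p \in ps)) => //= /ltps ->.
Qed.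

(** Sorting the ends of each chord yields one of the two alternating patterns in [valid_context]. *)
Lemma interlace_order a b c d : a != c -> a != d -> b != c -> b != d ->
  interlace a b c d ->
  (exists i i' j j', [/\ (i, i') = (a, b) \/ (i, i') = (b, a),
     (j, j') = (c, d) \/ (j, j') = (d, c) &
     (i < j < i') && (i' < j') \/ (j < i < j') && (j' < i')]).
Proof.
rewrite /interlace => ac ad bc bd h.
pose i := minn a b; pose i' := maxn a b; pose j := minn c d; pose j' := maxn c d.
exists i, i', j, j'; split.
- rewrite /i /i'; case: (leqP a b) => _; by [left|right].
- rewrite /j /j'; case: (leqP c d) => _; by [left|right].
- rewrite /i /i' /j /j'; lia.
Qed.

(** Serves both the pointer word and the second permutation of the theorem. *)
Lemma nth_flatten_pair (A B : Type) (a0 : A) (x0 : B) (f g : A -> B) (t : seq A) k :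
  k < size t ->
  nth x0 (flatten [seq [:: f a; g a] | a <- t]) k.*2 = f (nth a0 t k) /\
  nth x0 (flatten [seq [:: f a; g a] | a <- t]) k.*2.+1 = g (nth a0 t k).
Proof. by elim: t k => // a t IH [|k] //= kt; exact: IH. Qed.

Lemma size_flatten_pair (A B : Type) (f g : A -> B) (t : seq A) :
  size (flatten [seq [:: f a; g a] | a <- t]) = (size t).*2.
Proof. by elim: t => //= a t ->. Qed.

Section Contraction.

Variables (m : nat) (pi : 'S_m) (p : seq nat).
Hypothesis piE : oneline pi = rcons p 1.

Let T := (pi^-1)%g.

Lemma size_prefix : size p = m.-1.
Proof. by rewrite -(size_oneline pi) piE size_rcons. Qed.

Lemma mem_prefix k : (k \in p) = (1 < k <= m).
Proof.
have := mem_oneline pi k; have := oneline_uniq pi.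
rewrite piE mem_rcons inE rcons_uniq => /andP[np _]; case: eqVneq => [->|k1] /=.
  by rewrite (negbTE np).
by move=> ->; lia.
Qed.

Lemma index_prefix k : k \in p -> index k p = index k (oneline pi).
Proof. by move=> kp; rewrite piE -cats1 index_cat kp. Qed.

Lemma pos0 (i : 'I_m) : i = 0 :> nat -> T i = m.-1 :> nat.
Proof.
move=> i0; rewrite -index_oneline i0 piE -cats1 index_cat mem_prefix /=.
by rewrite addn0 size_prefix.
Qed.

Variable s : 'S_m.+1.
Hypothesis sE : oneline s = p ++ [:: m.+1; 1].

Lemma index_entry (i : 'I_m) : i != 0 :> nat -> index i.+1 (oneline s) = T i.
Proof.
move=> i0; have ip : i.+1 \in p by rewrite mem_prefix; have := ltn_ord i; lia.
by rewrite sE index_cat ip index_prefix // index_oneline.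
Qed.

Lemma index_max : index m.+1 (oneline s) = m.-1.
Proof. by rewrite sE index_cat mem_prefix ltnn andbF /= eqxx addn0 size_prefix. Qed.

Hypothesis m2 : 2 < m.

Lemma index_one : index 1 (oneline s) = m.
Proof.
rewrite sE index_cat mem_prefix /= eqSS (_ : (m == 0) = false); last by lia.
by rewrite size_prefix; lia.
Qed.

(** The wrap-around is correct because m + 1 occupies in [s] the place that 1 has in [pi]. *)
Lemma index_next (i : 'I_m) : index i.+2 (oneline s) = T (ordS i).
Proof.
have [[im i0]|[im iS]] := val_ordS i; first by rewrite pos0 // im index_max.
by rewrite -index_entry iS.
Qed.

Hypothesis pile : #|SP s| = m.

(** C moves from the gap after entry x to the gap before entry x + 1, which preserves the height by
    [height_chord]. The single cycle starts at the end of the word, where the height is even, and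
    reaches all gaps. *)
Lemma even_const (S : pred 'I_m) :
  (forall i, ~~ odd (\sum_(j | S j) cross T i j)) -> forall i j, S i = S j.
Proof.
move=> Sev.
pose G (x : 'I_m.+2) := forall i : 'I_m, x = i.+1 :> nat ->
  height T S (T i).*2.+2 = false.
have gap x : x != ord_max -> G x.
  apply: (pile_ind pile) => [||{}x x0 xm Gx]; first by lia.
    move=> i; rewrite val_cycC_max sE last_cat /= => -[i0].
    rewrite pos0 // (_ : m.-1.*2.+2 = m.*2); last by lia.
    exact: height_end.
  have xm' : x.-1 < m by have := ltn_ord x; rewrite -!val_eqE /= in x0 xm; lia.
  have xE : x = (Ordinal xm').+1 :> nat by rewrite -val_eqE /= in x0 *; lia.
  move=> i; rewrite val_cycC // xE index_next.
  have := height_chord T S (Ordinal xm'); rewrite (negbTE (Sev _)).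
  rewrite {1}/chord_out (Gx _ xE) /chord_in /=; set k := T _.
  (* If the entry after [x] in value stands first, C maps [x] to 0, where [G] holds vacuously. *)
  case kE: (nat_of_ord k) => [|k'] //= hk nk.
  have k'm : k' < m.-1 by have := ltn_ord k; lia.
  have ip : i.+1 = nth 0 p k' by rewrite -nk sE nth_cat size_prefix k'm.
  have -> : nat_of_ord (T i) = k'; last by rewrite -doubleS.
  rewrite -index_oneline ip -index_prefix ?index_uniq ?mem_nth ?size_prefix //.
  by have := oneline_uniq pi; rewrite piE rcons_uniq => /andP[].
have gap0 k : k <= m -> height T S k.*2 = false.
  case: k => [|k] km; first exact: height0.
  have im : ((T^-1)%g (Ordinal km)).+1 < m.+2 by have := ltn_ord ((T^-1)%g (Ordinal km)); lia.
  have /(gap (Ordinal im))/(_ _ erefl) : Ordinal im != ord_max.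
    by rewrite -val_eqE /=; have := ltn_ord ((T^-1)%g (Ordinal km)); lia.
  by rewrite permKV.
(* Equal heights on both sides of an entry put both of its letters in [S] or neither. *)
have Spred i : S i = S (ord_pred i).
  have := height_entry T S i; rewrite -doubleS !gap0 //; last exact: ltnW.
  by case: (S i); case: (S _).
have m0 : 0 < m by lia.
suff S0 i : S i = S (Ordinal m0) by move=> i j; rewrite !S0.
case: i => k; elim: k => [|k IH] km; first by congr S; apply: val_inj.
have km' : k < m by lia.
rewrite Spred -(IH km'); congr S; rewrite -[RHS]ordSK; congr ord_pred.
by apply: val_inj; have := val_ordS (Ordinal km') => /=; lia.
Qed.

(** The singleton of an isolated chord would satisfy the parity condition, hence be the whole
    diagram. *)
Lemma degree_gt0 i : 0 < \sum_j cross T i j.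
Proof.
rewrite lt0n; apply/negP; rewrite sum_nat_eq0 => /forallP no.
have /(_ i) ev : forall j k, (j == i) = (k == i).
  apply: (even_const (S := pred1 i)) => j; rewrite big_pred1_eq crossC.
  by have := no j; rewrite /= eqb0 => /negbTE ->.
have := ev (ordS i); rewrite eqxx => /esym/eqP e.
by have := val_ordS i; rewrite e; lia.
Qed.

(** The merged entry is spread in [s] over m + 1 and 1. Between its two letters stand only the two
    removed pointers, so the letters keep their order. *)
Lemma cross_context (i j : 'I_m) : cross T i j ->
  valid_context s (rptr i.+1) (rptr j.+1).
Proof.
move=> cij; have nij : i != j by apply: contraTneq cij => ->; rewrite crossnn.
rewrite /valid_context; apply/andP; split.
  by rewrite xpair_eqE eqSS (inj_eq val_inj) (negbTE nij).
pose f := flatten [seq [:: lptr k; rptr k] | k <- oneline s].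
have fs : size f = m.+1.*2 by rewrite size_flatten_pair size_oneline.
pose a (k : 'I_m) := (index k.+1 (oneline s)).*2.+1.
pose b (k : 'I_m) := (index k.+2 (oneline s)).*2.
have nthE k : 0 < k <= m.+1 ->
    [/\ nth (0, 0) f (index k (oneline s)).*2 = lptr k,
        nth (0, 0) f (index k (oneline s)).*2.+1 = rptr k
      & index k (oneline s) < m.+1].
  rewrite -(mem_oneline s) => ks.
  have ki : index k (oneline s) < size (oneline s) by rewrite index_mem.
  have [-> ->] := nth_flatten_pair 0 (0, 0) lptr rptr ki.
  by rewrite nth_index // -[X in _ < X](size_oneline s).
have aE k : nth (0, 0) f (a k) = rptr k.+1 /\ a k < size f.
  have := ltn_ord k => km; have [|_ -> ik] := nthE k.+1; first by lia.
  by split=> //; rewrite fs /a; lia.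
have bE k : nth (0, 0) f (b k) = rptr k.+1 /\ b k < size f.
  have := ltn_ord k => km; have [|-> _ ik] := nthE k.+2; first by lia.
  by split=> //; rewrite fs /b; lia.
(* Only the right pointer of 1 moves, by two places, and it remains the last letter. *)
have aT k : a k = chord_out T k \/ chord_out T k = m.*2.-1 /\ a k = m.*2.+1.
  rewrite /a /chord_out; have [k0|k0] := eqVneq (k : nat) 0; last first.
    by left; rewrite index_entry.
  by right; rewrite k0 index_one pos0 //; split=> //; lia.
have bT k : b k = chord_in T k by rewrite /b index_next.
have {}cij : interlace (a i) (b i) (a j) (b j) /\
    [/\ a i != a j, a i != b j, b i != a j & b i != b j].
  move: cij; rewrite /cross /interlace.
  have := (chord_out_eq T i j, chord_in_eq T i j); rewrite (negbTE nij) => -[no ni].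
  have := (chord_in_lt T i, chord_in_lt T j, chord_out_lt T i, chord_out_lt T j).
  have := (chord_out_in T i j, chord_out_in T j i).
  have := aT i; have := aT j; rewrite !bT.
  by move=> ? ? [? ?] [[[? ?] ?] ?] ?; split; [|split]; lia.
have sub4 p1 p2 p3 p4 : p1 < p2 -> p2 < p3 -> p3 < p4 -> p4 < size f ->
    subseq [:: nth (0, 0) f p1; nth (0, 0) f p2; nth (0, 0) f p3; nth (0, 0) f p4] f.
  move=> h1 h2 h3 h4; apply: (@subseq_nth _ (0, 0) f [:: p1; p2; p3; p4]).
    by rewrite /= h1 h2 h3.
  by rewrite /= h4 (ltn_trans h3 h4) (ltn_trans h2 (ltn_trans h3 h4))
    (ltn_trans h1 (ltn_trans h2 (ltn_trans h3 h4))).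
have sub_word t : {subset t <= [:: rptr i.+1; rptr j.+1]} -> subseq t f ->
    subseq t (pointer_word s).
  move=> tS tf; rewrite subseq_filter tf andbT; apply/allP => q /tS.
  have := ltn_ord i; have := ltn_ord j.
  by rewrite !inE => jm im /orP[] /eqP ->; rewrite /rptr !xpair_eqE; lia.
have [cr [n1 n2 n3 n4]] := cij.
have [i0 [i1 [j0 [j1 [hi hj ho]]]]] := interlace_order n1 n2 n3 n4 cr.
have at_end (k : 'I_m) x x' : (x, x') = (a k, b k) \/ (x, x') = (b k, a k) ->
    [/\ nth (0, 0) f x = rptr k.+1, nth (0, 0) f x' = rptr k.+1 & x' < size f].
  by have [? ?] := aE k; have [? ?] := bE k; case=> -[-> ->].
have [ei0 ei1 li] := at_end _ _ _ hi; have [ej0 ej1 lj] := at_end _ _ _ hj.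
apply/orP; case: ho => /andP[/andP[h1 h2] h3]; [left|right].
- apply: sub_word; last by have := sub4 _ _ _ _ h1 h2 h3 lj; rewrite ei0 ei1 ej0 ej1.
  by move=> q; rewrite !inE => /or4P[] ->; rewrite ?orbT.
- apply: sub_word; last by have := sub4 _ _ _ _ h1 h2 h3 li; rewrite ei0 ei1 ej0 ej1.
  by move=> q; rewrite !inE => /or4P[] ->; rewrite ?orbT.
Qed.

Lemma sum_cross_contexts :
  \sum_(i < m) \sum_(j < m | i < j) cross T i j <= num_contexts s.
Proof.
rewrite pair_big_dep /=.
pose E := [set ij : 'I_m * 'I_m | (ij.1 < ij.2) && cross T ij.1 ij.2].
have -> : \sum_(ij : 'I_m * 'I_m | ij.1 < ij.2) cross T ij.1 ij.2 = #|E|.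
  rewrite -sum1_card [RHS]big_mkcond [LHS]big_mkcond; apply: eq_bigr => ij _.
  by rewrite inE; case: (_ < _) => //; case: cross.
(* Chord [i] is the pointer (i + 1, i + 2), which [num_contexts] indexes by i + 1. *)
pose h (ij : 'I_m * 'I_m) := (lift ord0 ij.1, lift ord0 ij.2).
have h_inj : injective h.
  move=> [i j] [i' j'] /eqP; rewrite xpair_eqE !(inj_eq lift_inj).
  by case/andP=> /eqP /= -> /eqP /= ->.
rewrite -(card_imset _ h_inj); apply/subset_leq_card/subsetP => x /imsetP[[i j] ijE ->].
move: ijE; rewrite /E !inE /= => /andP[ij cij].
by rewrite /bump !add1n ltnS ij cross_context.
Qed.

(** All degrees are positive and even, so at least 2, while they sum to at most twice the [m]
    contexts. *)
Lemma degree2 : num_contexts s = m -> forall i, \sum_j cross T i j = 2.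
Proof.
move=> nc; have dge i : 2 <= \sum_j cross T i j.
  by have := degree_gt0 i; have := even_degree T i; lia.
have le : \sum_i \sum_j cross T i j <= \sum_(i < m) 2.
  rewrite (sum_sym_rel (crossC T) (crossnn T)) sum_nat_const card_ord muln2 leq_double.
  by rewrite -[leqRHS]nc sum_cross_contexts.
move=> i; move: le; rewrite (bigD1 i) // [leqRHS](bigD1 i) //= => le.
apply/eqP; rewrite eqn_leq dge andbT -(leq_add2r (\sum_(k < m | k != i) 2)).
by apply: leq_trans le; rewrite leq_add2l; apply: leq_sum.
Qed.

End Contraction.

(** * From positions to the two permutations *)

Lemma contraction_positions N m (s : 'S_N) (pi : 'S_m) : N = m.+1 -> 2 < m ->
  #|SP s| = m -> num_contexts s = m ->
  oneline pi = [seq k <- oneline s | k != N] -> entry pi m = 1 ->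
  (forall i : 'I_m, (pi^-1)%g i = m.-1 - i :> nat) \/
  (forall i : 'I_m, (pi^-1)%g i = (m.-1 + i.*2) %% m :> nat).
Proof.
(* [2 * n] is not a successor by conversion, hence the variable [N] and its substitution here. *)
move=> NE m2; move: s; rewrite {}NE => s pile nc ctr hlast.
have [p [sE piE]] := contraction_shape (ltnW m2) pile ctr hlast.
have ec := even_const piE sE m2 pile.
exact: positions ec (degree2 piE sE m2 pile nc) m2 (pos0 piE).
Qed.

Lemma oneline_index_eq n (pi : 'S_n) (t : seq nat) : size t = n ->
  (forall i : 'I_n, nth 0 t ((pi^-1)%g i) = i.+1) -> oneline pi = t.
Proof.
move=> st ht; apply: (@eq_from_nth _ 0) => [|k]; rewrite size_oneline // => kn.
rewrite (nth_map (Ordinal kn)) ?size_enum_ord //.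
rewrite -ht permK; congr nth; exact: nth_enum_ord.
Qed.

Theorem theorem4p26 (n : nat) (hn : 2 <= n) (pi : 'S_(2 * n - 1))
    (hM : pi \in M n (2 * n - 1)) (hlast : entry pi (2 * n - 1) = 1) :
  oneline pi = rev (iota 1 (2 * n - 1)) \/
  oneline pi = rcons (flatten [seq [:: n + j; j.+1] | j <- iota 1 (n - 1)]) 1.
Proof.
have [/= s /and3P[/eqP pile /eqP nc /eqP ctr]] : exists s : 'S_(2 * n),
   [&& maximal_SP s, num_contexts s == 2 * n - 1 & is_contraction s pi].
  by move: hM; rewrite inE => /existsP.
have NE : 2 * n = (2 * n - 1).+1 by lia.
have m2 : 2 < 2 * n - 1 by lia.
have hpos := contraction_positions NE m2 pile nc ctr hlast.
case: hpos => hpos; [left|right]; apply: oneline_index_eq.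
- by rewrite size_rev size_iota.
- move=> i; have := ltn_ord i => im.
  rewrite nth_rev size_iota hpos; last by lia.
  by rewrite nth_iota; lia.
- by rewrite size_rcons size_flatten_pair size_iota; lia.
- move=> i; have := ltn_ord i => im.
  rewrite nth_rcons size_flatten_pair size_iota hpos.
  set f := flatten _.
  have nf k : k < n - 1 -> nth 0 f k.*2 = n + k.+1 /\ nth 0 f k.*2.+1 = k.+2.
    move=> kn; have ks : k < size (iota 1 (n - 1)) by rewrite size_iota.
    have := nth_flatten_pair 0 0 (fun j => n + j) S ks.
    by rewrite nth_iota.
  have vE q v : (2 * n - 1).-1 + i.*2 = q * (2 * n - 1) + v -> v < 2 * n - 1 ->
      ((2 * n - 1).-1 + i.*2) %% (2 * n - 1) = v.
    by move=> -> vm; rewrite modnMDl modn_small.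
  (* The quotient by 2n - 1 is 0 for entry 1, 1 for entries 2 to n, and 2 for the larger ones;
     counted from 0, these stand at the last, the odd and the remaining even places. *)
  have [i0|[i1|i2]] : i = 0 :> nat \/ 0 < i < n \/ n <= i by lia.
  + by rewrite (vE 0 (n - 1).*2) ?ltnn ?eqxx ?i0; lia.
  + rewrite (vE 1 i.-1.*2.+1); [|lia|lia].
    have [|_ ->] := nf i.-1; first by lia.
    by case: ifP; lia.
  + rewrite (vE 2 (i - n).*2); [|lia|lia].
    have [|-> _] := nf (i - n); first by lia.
    by case: ifP; lia.
Qed.
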